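(* Let $n\ge2$ and let $X_1,\dots,X_n$ be nonnegative random variables, $X_{n:n}=\max_iX_i$, $S_n=\sum_{i=1}^nX_i$, such that the distribution function of $X_{n:n}$ has infinite upper endpoint, $X_{n:n}\in\mathrm{GMDA}(h)$ for some positive $h$, and $$\lim_{x\to\infty}\frac{\mathbb{P}(|X_i|>t h(x),X_j>x)}{\mathbb{P}(X_{n:n}>x)}=0\ \text{for all }1\le i\ne j\le n,\ t>0,$$ $$\lim_{x\to\infty}\frac{\mathbb{P}(X_i>Lh(x),X_j>Lh(x))}{\mathbb{P}(X_{n:n}>x)}=0\ \text{for all }1\le i<j\le n\text{ and some }L>0.$$ For a nonempty $\Omega\subset\{1,\dots,n\}$ let $$u=\liminf_{x\to\infty}\frac{\sum_{i\in\Omega}\mathbb{P}(X_i>x)}{\sum_{i=1}^n\mathbb{P}(X_i>x)},\qquad U=\limsup_{x\to\infty}\frac{\sum_{i\in\Omega}\mathbb{P}(X_i>x)}{\sum_{i=1}^n\mathbb{P}(X_i>x)}.$$ Then $$u\le\liminf_{q\to1}\frac{\mathbb{E}\big(\sum_{i\in\Omega}X_i\,\big|\,S_n>\mathrm{VaR}_q(S_n)\big)}{\mathrm{VaR}_q(S_n)}\le\limsup_{q\to1}\frac{\mathbb{E}\big(\sum_{i\in\Omega}X_i\,\big|\,S_n>\mathrm{VaR}_q(S_n)\big)}{\mathrm{VaR}_q(S_n)}\le U.$$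
   Context: For $q\in(0,1)$, $\mathrm{VaR}_q(S_n)=\inf\{x:\mathbb{P}(S_n\le x)\ge q\}$. For a distribution function $F$, $\overline{F}=1-F$, $x_F=\sup\{x:F(x)<1\}$; $F\in\mathrm{GMDA}(h)$ means $\lim_{x\to x_F}\overline{F}(x+yh(x))/\overline{F}(x)=e^{-y}$ for all $y\in\mathbb{R}$. Random variables are assumed not degenerate at $0$. *)

(* Defs.v *)
From HB Require Import structures.
From mathcomp Require Import all_boot all_order all_algebra.
From mathcomp Require Import all_classical all_reals all_analysis.
Set Implicit Arguments. Unset Strict Implicit. Unset Printing Implicit Defensive.
Import Order.TTheory GRing.Theory Num.Theory.
Import numFieldNormedType.Exports.
Local Open Scope classical_set_scope.
Local Open Scope ring_scope.

Section defs.
Context {R : realType} {d : measure_display} {T : measurableType d}.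
Variable P : probability T R.

Definition prob (A : set T) : R := fine (P A).

Definition Xmax n (X : 'I_n -> T -> R) (w : T) : R := \big[Num.max/0]_(i < n) X i w.
Definition Ssum n (X : 'I_n -> T -> R) (w : T) : R := \sum_(i < n) X i w.

Definition VaR (Y : T -> R) (q : R) : R := inf [set x | q <= prob [set w | Y w <= x]].

(* E( sum_{i in Om} X_i | S_n > VaR_q(S_n) ) / VaR_q(S_n), as an extended real;
   the conditional expectation given an event A is E(Y 1_A) / P(A) *)
Definition cte_ratio n (X : 'I_n -> T -> R) (Om : {set 'I_n}) (q : R) : \bar R :=
  let v := VaR (Ssum X) q in
  let A := [set w | v < Ssum X w] in
  ((\int[P]_(w in A) (\sum_(i in Om) X i w)%:E) * ((prob A * v)^-1)%:E)%E.
End defs.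

Section gmda.
Context {R : realType}.
Definition upper_endpoint (F : R -> R) : \bar R :=
  ereal_sup [set x%:E | x in [set x | F x < 1]].
Definition to_endpoint (F : R -> R) : set_system R :=
  match upper_endpoint F with
  | EFin r => r^'-
  | _ => pinfty_nbhs R
  end.
Definition GMDA (F : R -> R) (h : R -> R) : Prop :=
  forall y : R, (fun x => (1 - F (x + y * h x)) / (1 - F x)) @ to_endpoint F
                --> expR (- y).
End gmda.

(* Main.v *)
(* Write [F] and [G] for the tails of the maximum and of the sum. The Gumbel
   condition forces [h x = o(x)], [h (x - K h x) <= 2 h x] eventually, and
   rapid variation of [F]. If [S > x], then either two components exceed [L h],
   or one exceeds [t h] while another exceeds [x - n L h], or the maximum exceeds
   [x - n t h]; the first two events have probability [o(F x)], so letting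
   [t -> 0] gives [G ~ F]. Hence [G] is also rapidly varying and
   [E(S; S > x) <= (1 + o(1)) x G x].
   Finally [E(X_i; S > x) >= x P(X_i > x)] for every [i]. Summed over [Om] this
   is the lower bound; subtracting its sum over the complement of [Om] from
   [E(S; S > x)] gives the upper bound, because [G x <= (1 + o(1)) sum_i P(X_i > x)].
   It remains to substitute [x = VaR_q(S)], which tends to infinity as [q -> 1]. *)
Require Import Defs.
From HB Require Import structures.
From mathcomp Require Import all_boot all_order all_algebra.
From mathcomp Require Import all_classical all_reals all_analysis.
From mathcomp Require Import measurable_realfun.
From mathcomp Require Import ring lra.
Import Order.TTheory GRing.Theory Num.Theory.
Import numFieldNormedType.Exports.
Local Open Scope classical_set_scope.
Local Open Scope ring_scope.

(** * Limits inferior and superior along a change of variable *)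

Section limf_comp.
Context {R : realType} {S T : nbhsType} {F : set_system S} {G : set_system T}.
Context {FF : Filter F}.
Variables (f : S -> \bar R) (g : T -> \bar R) (phi : S -> T).
Hypothesis phiFG : phi @ F --> G.

(** For each [V] in [G], the points that [phi] sends into [V] and where the bound with [e] holds
    form a member of [F]; on it [f] is at most the supremum of [g] over [V] plus [e]. *)
Lemma limf_esup_comp_le :
  (forall e : R, 0 < e -> \forall x \near F, (f x <= g (phi x) + e%:E)%E) ->
  (limf_esup f F <= limf_esup g G)%E.
Proof.
move=> fg; rewrite [X in (_ <= X)%E]limf_esupE.
apply: le_ereal_inf_tmp => _ [V GV <-].
apply/lee_addgt0Pr => e e0; rewrite limf_esupE.
pose W := [set x | V (phi x) /\ (f x <= g (phi x) + e%:E)%E].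
have FW : F W by apply: filterI; [exact: phiFG | exact: fg].
apply: (@le_trans _ _ (ereal_sup (f @` W))); first by apply: ereal_inf_lbound; exists W.
apply: ge_ereal_sup => _ [x [Vx fgx] <-]; apply: (le_trans fgx).
by rewrite leeD2r //; apply: ereal_sup_ubound; exists (phi x).
Qed.

End limf_comp.

Lemma limf_einf_comp_ge {R : realType} {S T : nbhsType} {F : set_system S}
    {G : set_system T} {FF : Filter F} (f : S -> \bar R) (g : T -> \bar R)
    (phi : S -> T) : phi @ F --> G ->
  (forall e : R, 0 < e -> \forall x \near F, (g (phi x) <= f x + e%:E)%E) ->
  (limf_einf g G <= limf_einf f F)%E.
Proof.
move=> phiFG fg; rewrite /limf_einf leeN2.
apply: (limf_esup_comp_le _ _ phi phiFG) => e e0.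
near=> x; have : (g (phi x) <= f x + e%:E)%E by near: x; exact: fg.
(* Negation moves [e] across the inequality; infinite values are checked separately. *)
case: (f x) (g (phi x)) => [a| |] [b| |] //=; rewrite ?lee_fin => fgx //.
- lra.
- by rewrite leey.
- by rewrite leNye.
Unshelve. all: by end_near. Qed.

(** Two members of a proper filter share a point, and the value there separates the infimum over one
    from the supremum over the other. *)
Lemma limf_einf_le_esup {R : realType} {T : nbhsType} {F : set_system T}
  {FF : ProperFilter F} (f : T -> \bar R) : (limf_einf f F <= limf_esup f F)%E.
Proof.
rewrite limf_einfE limf_esupE; apply: ge_ereal_sup => _ [V FV <-].
apply: le_ereal_inf_tmp => _ [W FW <-].
have [x [Vx Wx]] := @filter_ex _ F _ _ (filterI FV FW).
by apply: (@le_trans _ _ (f x));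
  [apply: ereal_inf_lbound; exists x | apply: ereal_sup_ubound; exists x].
Qed.

(** * Gumbel tails *)

Section gumbel_tail.
Context {R : realType} {F h : R -> R}.
Hypothesis F_gt0 : forall x, 0 < F x.
Hypothesis F_noninc : {homo F : x y / x <= y >-> y <= x}.
Hypothesis F_neg : forall x, x < 0 -> F x = 1.
Hypothesis h_gt0 : forall x, 0 < h x.
Hypothesis F_gumbel :
  forall y, (fun x => F (x + y * h x) / F x) @ +oo --> expR (- y).

Lemma gumbel_tail_le y c : expR (- y) < c ->
  \forall x \near +oo, F (x + y * h x) <= c * F x.
Proof.
move=> yc; apply: filterS (cvgr_lt _ (F_gumbel y) _ yc) => x.
by rewrite ltr_pdivrMr// => /ltW.
Qed.

Lemma gumbel_tail_ge y c : c < expR (- y) ->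
  \forall x \near +oo, c * F x <= F (x + y * h x).
Proof.
move=> yc; apply: filterS (cvgr_gt _ (F_gumbel y) _ yc) => x.
by rewrite ltr_pdivlMr// => /ltW.
Qed.

(* If [h x > c x], then [x + y h x < 0] for two different values of [y], and
   [F (x + y h x) / F x = 1 / F x] cannot be close to both [expR (- y)]. *)
Lemma gumbel_scale_small c : 0 < c -> \forall x \near +oo, h x <= c * x.
Proof.
(* [h x > c * x] makes [x + y * h x] negative already at [y = - c^-1]; the exponents shifted by 1
   and 2 then bound [1 / F x] incompatibly. *)
move=> c0; pose y := - c^-1.
have lim1 : expR (- y) < expR (- y + 1) by rewrite ltr_expR; lra.
have lim2 : expR (- y + 2) < expR (- (y - 3)) by rewrite ltr_expR; lra.
near=> x; rewrite leNgt; apply/negP => hx.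
have x0 : 0 < x by near: x; exact: nbhs_pinfty_gt (num_real _).
have h0 := h_gt0 x.
have xy : x + y * h x < 0.
  by rewrite /y mulNr subr_lt0 mulrC ltr_pdivlMr// mulrC.
have H1 : F (x + y * h x) <= expR (- y + 1) * F x.
  by near: x; exact: gumbel_tail_le.
have H2 : expR (- y + 2) * F x <= F (x + (y - 3) * h x).
  by near: x; exact: gumbel_tail_ge.
rewrite F_neg// in H1; rewrite (F_neg (x + (y - 3) * h x)) in H2; last by rewrite mulrBl; lra.
have : expR (- y + 1) * F x < expR (- y + 2) * F x by rewrite ltr_pM2r// ltr_expR; lra.
by lra.
Unshelve. all: by end_near. Qed.

(** As [h x = o(x)], the point [a * x] eventually lies beyond [x + y * h x] for any fixed [y];
    taking [y > - ln e] makes [expR (- y) < e]. *)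
Lemma gumbel_rapid_variation a e : 1 < a -> 0 < e ->
  \forall x \near +oo, F (a * x) <= e * F x.
Proof.
move=> a1 e0; pose y := 1 + `|ln e|.
have y0 : 0 < y by rewrite /y ltr_pwDl.
have ye : expR (- y) < e.
  rewrite -[ltRHS]lnK ?posrE// ltr_expR /y.
  by have := ler_norm (- ln e); rewrite normrN; lra.
have c0 : 0 < (a - 1) / y by rewrite divr_gt0// subr_gt0.
near=> x; have hx : h x <= (a - 1) / y * x by near: x; exact: gumbel_scale_small.
apply: (@le_trans _ _ (F (x + y * h x))); last by near: x; exact: gumbel_tail_le.
apply: F_noninc; move: hx; rewrite mulrAC ler_pdivlMr//; lra.
Unshelve. all: by end_near. Qed.

Lemma gumbel_shift_cvgy K : 0 < K -> (fun x => x - K * h x) @ +oo --> +oo.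
Proof.
move=> K0; apply/cvgryPge => A.
(* This constant leaves [x - K * h x >= x / 2]. *)
have c0 : 0 < (2 * K)^-1 by rewrite invr_gt0; lra.
near=> x; have : h x <= (2 * K)^-1 * x by near: x; exact: gumbel_scale_small.
rewrite ler_pdivlMl; last lra.
suff : 2 * A <= x by lra.
by near: x; exact: nbhs_pinfty_ge (num_real _).
Unshelve. all: by end_near. Qed.

(* With [x' = x - K h x], if [h x' > 2 h x] then [F (x' + h x')] is at most
   [F (x + (2 - K) h x) ~ expR (- 2) F x'], whereas it is close to
   [expR (- 1) F x']. *)
Lemma gumbel_scale_shift K : 0 < K ->
  \forall x \near +oo, h (x - K * h x) <= 2 * h x.
Proof.
move=> K0.
(* Each limit gives up [1 / 4] in the exponent; the contradiction survives since
   [- 5 / 4 + (K - 1 / 4) > K - 7 / 4]. *)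
have e1 : expR (- (5 / 4)) < expR (- 1) :> R by rewrite ltr_expR; lra.
have e2 : expR (- (2 - K)) < expR (K - 7 / 4) :> R by rewrite ltr_expR; lra.
have e3 : expR (K - 1 / 4) < expR (- (- K)) :> R by rewrite ltr_expR; lra.
near=> x; rewrite leNgt; apply/negP => hx.
have H1 : expR (- (5 / 4)) * F (x - K * h x) <=
    F ((x - K * h x) + 1 * h (x - K * h x)).
  by near: x; exact: (gumbel_shift_cvgy _ K0 _ (gumbel_tail_ge _ _ e1)).
have H2 : F (x + (2 - K) * h x) <= expR (K - 7 / 4) * F x.
  by near: x; exact: gumbel_tail_le.
have H3 : expR (K - 1 / 4) * F x <= F (x + (- K) * h x).
  by near: x; exact: gumbel_tail_ge.
have H4 : F ((x - K * h x) + 1 * h (x - K * h x)) <= F (x + (2 - K) * h x).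
  by apply: F_noninc; lra.
have H5 : expR (- (5 / 4)) * (expR (K - 1 / 4) * F x) <=
    expR (- (5 / 4)) * F (x - K * h x).
  by rewrite ler_pM2l ?expR_gt0//; move: H3; rewrite mulNr.
have : expR (K - 7 / 4) * F x < expR (- (5 / 4)) * (expR (K - 1 / 4) * F x).
  by rewrite mulrA -expRD ltr_pM2r// ltr_expR; lra.
by lra.
Unshelve. all: by end_near. Qed.

End gumbel_tail.

(** * Probabilities and tails *)

Section prob_theory.
Context {R : realType} {d : measure_display} {T : measurableType d}.
Variable P : probability T R.
Implicit Types (A B : set T) (Y : T -> R).

Lemma probE A : measurable A -> P A = (prob P A)%:E.
Proof. by move=> mA; rewrite fineK// fin_num_measure. Qed.

Lemma prob_ge0 A : 0 <= prob P A.
Proof. exact: fine_ge0. Qed.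

Lemma le_prob A B : measurable A -> measurable B -> A `<=` B ->
  prob P A <= prob P B.
Proof.
by move=> mA mB AB; rewrite -lee_fin -!probE// le_measure// inE.
Qed.

Lemma probC A : measurable A -> prob P (~` A) = 1 - prob P A.
Proof.
move=> mA; apply/EFin_inj; rewrite EFinB -!probE//; last exact: measurableC.
exact: probability_setC.
Qed.

(** Finite union bound, with the cover given pointwise so that a case analysis on outcomes can be
    used directly. *)
Lemma prob_cover_le (I : finType) (Q : pred I) (A : I -> set T) B :
  (forall i, measurable (A i)) -> measurable B ->
  (forall w, B w -> exists2 i, Q i & A i w) ->
  prob P B <= \sum_(i | Q i) prob P (A i).
Proof.
move=> mA mB BA.
have [mU leU] : measurable (\big[setU/set0]_(i | Q i) A i) /\
    prob P (\big[setU/set0]_(i | Q i) A i) <= \sum_(i | Q i) prob P (A i).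
  elim/big_rec2: _ => [|i r U _ [mU leU]].
    by split => //; rewrite /prob measure0.
  have mAU := measurableU _ _ (mA i) mU; split => //.
  apply: le_trans (lerD (lexx _) leU).
  by rewrite -lee_fin EFinD -!probE// measureU2.
apply: (le_trans _ leU); apply: le_prob => // w /BA[i Qi Aiw].
by rewrite -bigcup_seq_cond; exists i => //=; rewrite mem_index_enum.
Qed.

Lemma measurable_tail Y x : measurable_fun setT Y -> measurable [set w | x < Y w].
Proof.
move=> mY; rewrite -[X in measurable X]setTI.
rewrite [X in _ `&` X](_ : _ = Y @^-1` `]x, +oo[%classic); last first.
  by apply/seteqP; split => w /=; rewrite in_itv/= andbT.
exact: mY.
Qed.

Lemma measurable_layer Y (u v : R) : measurable_fun setT Y ->
  measurable [set w | u < Y w <= v].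
Proof.
move=> mY; rewrite (_ : [set w | _] = [set w | u < Y w] `\` [set w | v < Y w]).
  by apply: measurableD; exact: measurable_tail.
apply/seteqP; split => w /=.
  by move=> /andP[-> vY]; split => //; rewrite ltNge vY.
by move=> [-> /negP]; rewrite -leNgt.
Qed.

Lemma prob_le_tail Y x : measurable_fun setT Y ->
  prob P [set w | Y w <= x] = 1 - prob P [set w | x < Y w].
Proof.
move=> mY; rewrite -probC; last exact: measurable_tail.
by congr prob; apply/seteqP; split => w /=; [rewrite leNgt|rewrite leNgt]; move/negP.
Qed.

Lemma tail_noninc Y : measurable_fun setT Y ->
  {homo (fun x => prob P [set w | x < Y w]) : x y / x <= y >-> y <= x}.
Proof.
move=> mY x y xy; apply: le_prob; [exact: measurable_tail..|].
by move=> w /=; exact: le_lt_trans.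
Qed.

(* One step of the layering [{y < Y <= b} = {y < Y <= a y} U {a y < Y <= b}]
   costs at most [a y G y], and rapid variation makes the costs of the
   successive layers decay geometrically; [c <= (a - 1) y] guarantees that
   finitely many layers reach [b]. *)
Let integral_layers_le Y (a del e M c b : R) k : measurable_fun setT Y ->
  1 < a -> 0 <= e -> 0 < M -> c <= (a - 1) * M -> a + a * del * (1 + e) <= 1 + e ->
  let G x := prob P [set w | x < Y w] in
  (forall y : R, M < y -> G (a * y) <= del * G y) ->
  forall y : R, M < y -> b <= y + k%:R * c ->
  (\int[P]_(w in [set w | (y < Y w <= b)%R]) (Y w)%:E
     <= ((1 + e) * (y * G y))%:E)%E.
Proof.
move=> mY a1 e0 M0 cM ae G Gdel.
have mI (u v : R) : measurable [set w | (u < Y w <= v)%R] by exact: measurable_layer.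
have G0 u : 0 <= G u by exact: prob_ge0.
elim: k => [|k IH] y My yb.
  rewrite (_ : [set w | _] = set0); last first.
    apply/seteqP; split => w //= /andP[yY Yb]; lra.
  by rewrite integral_set0 lee_fin !mulr_ge0//; lra.
have ya : y <= a * y by nra.
have mYE D : measurable D -> measurable_fun D (EFin \o Y).
  by move=> mD; apply/measurable_EFinP; exact: measurable_funTS.
apply: (@le_trans _ _ (\int[P]_(w in [set w | (y < Y w <= a * y)%R] `|`
    [set w | (a * y < Y w <= b)%R]) (Y w)%:E)%E).
  apply: ge0_subset_integral => //; [exact: measurableU|exact/mYE/measurableU| |].
    by move=> w /= [] /andP[yY _]; rewrite lee_fin; lra.
  by move=> w /= /andP[yY Yb]; case: (leP (Y w) (a * y)) => ?; [left|right]; rewrite ?yY ?Yb.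
rewrite ge0_integral_setU//; last 3 first.
- exact/mYE/measurableU.
- by move=> w /= [] /andP[yY _]; rewrite lee_fin; lra.
- apply/disj_setPS => w /= [/andP[_ h1] /andP[h2 _]]; lra.
have I1 : (\int[P]_(w in [set w | (y < Y w <= a * y)%R]) (Y w)%:E
    <= (a * y * G y)%:E)%E.
  apply: (@le_trans _ _ (\int[P]_(w in [set w | (y < Y w <= a * y)%R]) (cst (a * y)%:E w))%E).
    apply: ge0_le_integral => //; [|exact: mYE|].
      by move=> w /= /andP[yY _]; rewrite lee_fin; lra.
    by move=> w /= /andP[_]; rewrite lee_fin.
  rewrite integral_cst//. rewrite [X in (_ * X)%E](probE _ (mI _ _)) -EFinM lee_fin ler_wpM2l//; first lra.
  by apply: le_prob => //; [exact: measurable_tail | move=> w /= /andP[]].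
have I2 := IH (a * y) _ _.
apply: (le_trans (leeD I1 (I2 _ _))); [lra| |].
  (* As [y > M], the first layer has width [(a - 1) * y >= c], so [k] steps remain enough. *)
  by move: yb; rewrite -natr1; nra.
rewrite -EFinD lee_fin.
have Gy := Gdel _ My.
have : (1 + e) * (a * y) * G (a * y) <= (1 + e) * (a * y) * (del * G y).
  by rewrite ler_wpM2l// mulr_ge0//; lra.
have : (a + a * del * (1 + e)) * (y * G y) <= (1 + e) * (y * G y).
  by rewrite ler_wpM2r// mulr_ge0//; lra.
lra.
Qed.

(** The bound on layers does not depend on the upper cut [b]; monotone convergence along integer
    cuts removes it. *)
Lemma rapid_variation_tail_integral Y : measurable_fun setT Y ->
  let G x := prob P [set w | x < Y w] in
  (forall a e, 1 < a -> 0 < e -> \forall x \near +oo, G (a * x) <= e * G x) ->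
  forall e, 0 < e -> \forall x \near +oo,
    (\int[P]_(w in [set w | (x < Y w)%R]) (Y w)%:E
      <= ((1 + e) * (x * G x))%:E)%E.
Proof.
move=> mY G rapid e e0.
pose a := 1 + e / 4; have a1 : 1 < a by rewrite /a; lra.
(* Chosen so that [a * del * (1 + e) = e / 2], which with [a = 1 + e / 4] stays below [1 + e]. *)
pose del := e / (2 * a * (1 + e)).
have aD0 : 0 < 2 * a * (1 + e) by rewrite !mulr_gt0//; lra.
have del0 : 0 < del by rewrite divr_gt0.
have ae : a + a * del * (1 + e) <= 1 + e.
  rewrite (_ : a * del * (1 + e) = e / 2); first by rewrite /a; lra.
  by rewrite /del; field; rewrite !gt_eqF//; lra.
have [M [_ GM]] := rapid _ _ a1 del0.
near=> x.
have x0 : 0 < x by near: x; exact: nbhs_pinfty_gt (num_real _).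
have Mx : M < x by near: x; exact: nbhs_pinfty_gt (num_real _).
(* The layers need a positive threshold in order to advance; [x / 2] provides one that is still
   below [x]. *)
pose M' := Num.max M (x / 2).
have M'0 : 0 < M' by rewrite /M' lt_max; apply/orP; right; lra.
have M'x : M' < x by rewrite /M' gt_max Mx/=; lra.
have GM' y : M' < y -> G (a * y) <= del * G y.
  by rewrite /M' gt_max => /andP[My _]; exact: GM.
pose A N := [set w | (x < Y w <= N%:R)%R].
have mA N : measurable (A N) by exact: measurable_layer.
have AE : \bigcup_N A N = [set w | (x < Y w)%R].
  apply/seteqP; split => [w [N _ /andP[]]//|w /= xY].
  exists (Num.bound `|Y w|) => //=; rewrite /A/= xY ltW// (le_lt_trans (ler_norm _))//.
  exact: archi_boundP.
have cv : (\int[P]_(w in A N) (Y w)%:E)%E @[N --> \oo] -->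
    (\int[P]_(w in \bigcup_N A N) (Y w)%:E)%E.
  apply: ge0_nondecreasing_set_cvg_integral => //.
  - move=> N N' NN'; apply/subsetPset => w /= /andP[xY YN].
    by rewrite /A/= xY (le_trans YN)// ler_nat.
  - by move=> N; apply/measurable_EFinP; exact: measurable_funTS.
  - by move=> N w /= /andP[xY _]; rewrite lee_fin; lra.
rewrite -AE -(cvg_lim _ cv)//; apply: lime_le; first by apply/cvg_ex; eexists; exact: cv.
apply: nearW => N.
pose c := (a - 1) * M'; have c0 : 0 < c by rewrite mulr_gt0//; lra.
apply: (integral_layers_le _ a del e M' c _ (Num.bound (N%:R / c))) => //; first exact: ltW.
have : N%:R / c < (Num.bound (N%:R / c))%:R by apply: archi_boundP; rewrite divr_ge0// ltW.
by rewrite ltr_pdivrMr//; lra.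
Unshelve. all: by end_near. Qed.

End prob_theory.

(** * Tail of the sum *)

Lemma sum_le_except {R : realDomainType} {n : nat} (a : 'I_n -> R) (j : 'I_n) (l : R) :
  0 <= l -> (forall i, i != j -> a i <= l) -> \sum_i a i <= a j + n%:R * l.
Proof.
move=> l0 al; rewrite (bigD1 j)//= lerD2l.
apply: (@le_trans _ _ (\sum_(i | i != j) l)); first exact: ler_sum.
have -> : n%:R * l = \sum_(i < n) l by rewrite sumr_const card_ord mulr_natl.
by rewrite [leRHS](bigD1 j)//= lerDr.
Qed.

(** Let [a j] be the largest term. If all others are at most [t], then [a j > x - n t]. If another
    exceeds [l], so does [a j]. Otherwise some other term exceeds [t] while all others are at most
    [l], hence [a j > x - n l]. *)
Lemma large_sum_cases {R : realType} {n : nat} (a : 'I_n -> R) (l t x : R) :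
  (0 < n)%N -> 0 <= l -> 0 <= t -> x < \sum_i a i ->
  [\/ exists i j, [/\ i != j, l < a i & l < a j],
      exists i j, [/\ i != j, t < a i & x - n%:R * l < a j]
    | x - n%:R * t < \big[Num.max/0]_i a i].
Proof.
move=> n0 l0 t0 xS.
have [j aj] : exists j, forall i, a i <= a j.
  have [j _ aj] := @arg_maxP _ _ _ (Ordinal n0) predT a isT.
  by exists j => i; exact: aj.
have [[i [ij ti]]|small] := pselect (exists i, i != j /\ t < a i); last first.
  apply: Or33; have : \sum_i a i <= a j + n%:R * t.
    apply: sum_le_except => // i ij; rewrite leNgt; apply/negP => ti.
    by apply: small; exists i.
  have := le_bigmax 0 a j; lra.
have [[k [kj lk]]|lsmall] := pselect (exists k, k != j /\ l < a k).
  by apply: Or31; exists k, j; split => //; exact: lt_le_trans lk (aj k).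
apply: Or32; exists i, j; split => //.
have : \sum_i a i <= a j + n%:R * l; last lra.
apply: sum_le_except => // k kj; rewrite leNgt; apply/negP => lk.
by apply: lsmall; exists k.
Qed.

Section max_sum.
Context {R : realType} {d : measure_display} {T : measurableType d}.
Variables (P : probability T R) (n : nat) (X : 'I_n -> T -> R).
Hypothesis mX : forall i, measurable_fun setT (X i).
Hypothesis X0 : forall i w, 0 <= X i w.

Let Fb x := prob P [set w | x < Xmax X w].
Let G x := prob P [set w | x < Ssum X w].

Lemma measurable_Ssum : measurable_fun setT (Ssum X).
Proof. exact: measurable_sum. Qed.

Lemma measurable_Xmax : measurable_fun setT (Xmax X).
Proof.
rewrite /Xmax; elim: (index_enum _) => [|i s IH].
  by under eq_fun do rewrite big_nil; exact: measurable_cst.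
under eq_fun do rewrite big_cons.
exact: measurable_maxr.
Qed.

Lemma Xmax_ge0 w : 0 <= Xmax X w.
Proof. exact: bigmax_ge_id. Qed.

Lemma Ssum_ge0 w : 0 <= Ssum X w.
Proof. by apply: sumr_ge0 => i _. Qed.

Lemma Xmax_le_Ssum w : Xmax X w <= Ssum X w.
Proof.
apply: bigmax_le => [|i _]; first exact: Ssum_ge0.
by rewrite /Ssum (bigD1 i)//= lerDl sumr_ge0.
Qed.

Lemma Xmax_tail_le_Ssum x : Fb x <= G x.
Proof.
apply: le_prob; [exact/measurable_tail/measurable_Xmax|
  exact/measurable_tail/measurable_Ssum|].
by move=> w /= /lt_le_trans; apply; exact: Xmax_le_Ssum.
Qed.

Lemma Xmax_tail_le_sum (x : R) : 0 <= x -> Fb x <= \sum_i prob P [set w | x < X i w].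
Proof.
move=> x0; apply: prob_cover_le => [i||w /= xM].
- exact: measurable_tail.
- exact/measurable_tail/measurable_Xmax.
apply: contrapT => noX; have : Xmax X w <= x; last by rewrite leNgt xM.
(* [0 <= x] handles the initial value [0] of the iterated maximum. *)
apply: bigmax_le => // i _; rewrite leNgt; apply/negP => xi.
by apply: noX; exists i.
Qed.

Lemma Xmax_tail_neg (x : R) : x < 0 -> Fb x = 1.
Proof.
move=> x0; rewrite /Fb (_ : [set w | _] = setT).
  by rewrite /prob probability_setT.
by apply/seteqP; split => w //= _; exact: lt_le_trans x0 (Xmax_ge0 w).
Qed.

(** A zero of the tail at [x] would persist beyond [x] and bound the upper endpoint by [x]. *)
Lemma Xmax_tail_gt0 :
  upper_endpoint (fun x => prob P [set w | Xmax X w <= x]) = +oo%E ->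
  forall x, 0 < Fb x.
Proof.
move=> endp x; rewrite lt_neqAle prob_ge0 andbT; apply/eqP => Fx0.
set F := fun y => _ in endp; have : (upper_endpoint F <= x%:E)%E.
  apply: ge_ereal_sup => _ [y /= Fy <-]; rewrite lee_fin leNgt; apply/negP => xy.
  move: Fy; rewrite /F prob_le_tail; last exact: measurable_Xmax.
  have := tail_noninc P _ measurable_Xmax x y (ltW xy).
  by rewrite -/(Fb x) -Fx0; lra.
by rewrite endp leye_eq.
Qed.

Section tail.
Variable h : R -> R.
Hypothesis n_gt0 : (0 < n)%N.
Hypothesis Fb_gt0 : forall x, 0 < Fb x.
Hypothesis h_gt0 : forall x, 0 < h x.
Hypothesis gumbel :
  forall y, (fun x => Fb (x + y * h x) / Fb x) @ +oo --> expR (- y).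
Hypothesis asym_indep : forall i j : 'I_n, i != j -> forall t : R, 0 < t ->
  (fun x => prob P [set w | t * h x < `|X i w| /\ x < X j w] / Fb x) @ +oo --> 0.
Variable L : R.
Hypothesis L_gt0 : 0 < L.
Hypothesis no_pair : forall i j : 'I_n, (i < j)%N ->
  (fun x => prob P [set w | L * h x < X i w /\ L * h x < X j w] / Fb x) @ +oo --> 0.

Let Fb_noninc : {homo Fb : x y / x <= y >-> y <= x}.
Proof. exact/tail_noninc/measurable_Xmax. Qed.

Let cvg0_le (f : R -> R) (e : R) : 0 < e -> (fun x => f x / Fb x) @ +oo --> 0 ->
  \forall x \near +oo, f x <= e * Fb x.
Proof.
move=> e0 f0; apply: filterS (cvgr_lt _ f0 _ e0) => x.
by rewrite ltr_pdivrMr// => /ltW.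
Qed.

(** The event is symmetric in the pair, which extends [i < j] to [i != j]; finiteness gives one
    neighbourhood for all pairs. *)
Let no_pair_le (e : R) : 0 < e -> \forall x \near +oo, forall p : 'I_n * 'I_n,
  p.1 != p.2 -> prob P [set w | L * h x < X p.1 w /\ L * h x < X p.2 w] <= e * Fb x.
Proof.
move=> e0; apply: filter_forall => -[i j] /=.
have [->|ij] := eqVneq i j; first by near=> x.
have [lij|lji|/val_inj eij] := ltngtP i j; last by rewrite eij eqxx in ij.
  by near=> x => _; near: x; exact: (cvg0_le _ _ e0 (no_pair _ _ lij)).
near=> x => _; under eq_set do rewrite andC.
by near: x; exact: (cvg0_le _ _ e0 (no_pair _ _ lji)).
Unshelve. all: by end_near. Qed.

(* The threshold [x - K h x] in [X p.2] is compensated by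
   [Fb (x - K h x) = O (Fb x)] and [h (x - K h x) <= 2 h x]. *)
Let asym_indep_le (t K e : R) : 0 < t -> 0 < K -> 0 < e ->
  \forall x \near +oo, forall p : 'I_n * 'I_n, p.1 != p.2 ->
  prob P [set w | t * h x < X p.1 w /\ x - K * h x < X p.2 w] <= e * Fb x.
Proof.
move=> t0 K0 e0; apply: filter_forall => -[i j] /=.
have [->|ij] := eqVneq i j; first by near=> x.
have t2 : 0 < t / 2 by rewrite divr_gt0.
have e' : 0 < e / expR (K + 1) by rewrite divr_gt0// expR_gt0.
have KK : expR (- (- K)) < expR (K + 1) by rewrite ltr_expR; lra.
have key := cvg0_le _ _ e' (asym_indep i j ij _ t2).
have shift := gumbel_shift_cvgy Fb_gt0 Xmax_tail_neg h_gt0 gumbel K K0.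
near=> x => _.
apply: (@le_trans _ _ (prob P [set w | t / 2 * h (x - K * h x) < `|X i w|
    /\ x - K * h x < X j w])).
  have mYX (u v : R) (i' j' : T -> R) : measurable_fun setT i' -> measurable_fun setT j' ->
      measurable [set w : T | u < i' w /\ v < j' w].
    by move=> mi mj; apply: measurableI; exact: measurable_tail.
  apply: le_prob; [exact: mYX| |].
    by apply: mYX => //; exact: measurableT_comp.
  move=> w /= [ti xj]; split => //; rewrite ger0_norm//.
  apply: le_lt_trans ti.
  have : h (x - K * h x) <= 2 * h x.
    by near: x; exact: (gumbel_scale_shift Fb_gt0 Fb_noninc Xmax_tail_neg h_gt0 gumbel).
  by move=> h2; have := ler_wpM2l (ltW t2) h2; lra.
apply: (@le_trans _ _ (e / expR (K + 1) * Fb (x - K * h x))).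
  by near: x; exact: (shift _ key).
have F2 : Fb (x - K * h x) <= expR (K + 1) * Fb x.
  rewrite -mulNr; near: x; exact: gumbel_tail_le.
rewrite mulrAC ler_pdivrMr ?expR_gt0//.
by have := ler_wpM2l (ltW e0) F2; lra.
Unshelve. all: by end_near. Qed.

Lemma Ssum_tail_le (e : R) : 0 < e -> \forall x \near +oo, G x <= (1 + e) * Fb x.
Proof.
(* With [n t = tau], the maximum contributes a factor [expR tau = 1 + e / 4], relaxed to
   [1 + e / 2]; [del] makes each family of at most [n ^ 2] pairs cost at most [e / 4]. *)
move=> e0; pose tau := ln (1 + e / 4).
have tau0 : 0 < tau by rewrite ln_gt0//; lra.
have nR0 : 0 < n%:R :> R by rewrite ltr0n.
pose t := tau / n%:R; have t0 : 0 < t by rewrite divr_gt0.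
have K0 : 0 < n%:R * L by rewrite mulr_gt0.
pose del := e / (4 * n%:R ^+ 2).
have del0 : 0 < del by rewrite divr_gt0// mulr_gt0// exprn_gt0.
have taue : expR (- (- tau)) < 1 + e / 2.
  by rewrite opprK lnK ?posrE; lra.
have key := gumbel_tail_le Fb_gt0 gumbel _ _ taue.
near=> x.
(* One index type collects the three kinds of events, so that a single union bound applies. *)
pose A (s : unit + ('I_n * 'I_n + 'I_n * 'I_n)) := match s with
  | inl _ => [set w | x - tau * h x < Xmax X w]
  | inr (inl p) => [set w | L * h x < X p.1 w /\ L * h x < X p.2 w]
  | inr (inr p) => [set w | t * h x < X p.1 w /\ x - n%:R * L * h x < X p.2 w]
  end.
pose Q (s : unit + ('I_n * 'I_n + 'I_n * 'I_n)) := match s with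
  | inl _ => true | inr (inl p) => p.1 != p.2 | inr (inr p) => p.1 != p.2 end.
have mA s : measurable (A s).
  case: s => [_|[p|p]] /=; first exact/measurable_tail/measurable_Xmax.
    by apply: measurableI; exact: measurable_tail.
  by apply: measurableI; exact: measurable_tail.
have GA : G x <= \sum_(s | Q s) prob P (A s).
  apply: prob_cover_le => //; first exact/measurable_tail/measurable_Ssum.
  move=> w /= xS.
  have := large_sum_cases (X^~ w) (L * h x) (t * h x) x n_gt0 _ _ xS.
  case=> [| |[i [j [ij Li Lj]]]|[i [j [ij ti xj]]]|xM].
  - by rewrite mulr_ge0// ltW.
  - by rewrite mulr_ge0// ltW.
  - by exists (inr (inl (i, j))).
  - by exists (inr (inr (i, j))) => //=; split => //; rewrite -mulrA.
  - exists (inl tt) => //=; move: xM.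
    by rewrite /t mulrA mulrCA mulfV ?gt_eqF// mulr1.
have sum_pairs (f : 'I_n * 'I_n -> R) : (forall p, p.1 != p.2 -> f p <= del * Fb x) ->
    \sum_(p | p.1 != p.2) f p <= e / 4 * Fb x.
  move=> fdel; have dF : 0 <= del * Fb x by rewrite mulr_ge0// ltW.
  apply: (@le_trans _ _ (\sum_(p : 'I_n * 'I_n) del * Fb x)).
    rewrite [leLHS]big_mkcond; apply: ler_sum => p _; case: ifPn => // pp.
    exact: fdel.
  have -> : \sum_(p : 'I_n * 'I_n) del * Fb x = n%:R ^+ 2 * (del * Fb x).
    by rewrite sumr_const card_prod card_ord -[LHS]mulr_natl natrM.
  rewrite /del le_eqVlt; apply/orP; left.
  by apply/eqP; field; rewrite gt_eqF.
apply: (le_trans GA); rewrite !big_sumType /= (big_pred1 tt); last by case.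
have P1 : prob P [set w | x - tau * h x < Xmax X w] <= (1 + e / 2) * Fb x.
  by rewrite -mulNr; near: x.
have P2 := sum_pairs (fun p => prob P [set w | L * h x < X p.1 w /\ L * h x < X p.2 w]) _.
have P3 := sum_pairs (fun p => prob P [set w | t * h x < X p.1 w
  /\ x - n%:R * L * h x < X p.2 w]) _.
apply: (le_trans (lerD P1 (lerD (P2 _) (P3 _)))); last lra.
  by near: x; exact: no_pair_le.
by near: x; exact: asym_indep_le.
Unshelve. all: by end_near. Qed.

(** Rapid variation passes from [Fb] to [G] by [G (a x) <= 2 Fb (a x) <= e Fb x <= e G x]. *)
Lemma Ssum_rapid_variation (a e : R) : 1 < a -> 0 < e ->
  \forall x \near +oo, G (a * x) <= e * G x.
Proof.
move=> a1 e0.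
have acvg : (fun x : R => a * x) @ +oo --> +oo.
  apply/cvgryPge => A; near=> x.
  have x0 : 0 <= x by near: x; exact: nbhs_pinfty_ge (num_real _).
  have Ax : A <= x by near: x; exact: nbhs_pinfty_ge (num_real _).
  by nra.
have e2 : 0 < e / 2 by rewrite divr_gt0.
near=> x.
have H1 : G (a * x) <= (1 + 1) * Fb (a * x).
  by near: x; exact: (acvg _ (Ssum_tail_le _ ltr01)).
have H2 : Fb (a * x) <= e / 2 * Fb x.
  by near: x; exact: (gumbel_rapid_variation Fb_gt0 Fb_noninc Xmax_tail_neg h_gt0 gumbel).
have := ler_wpM2l (ltW e0) (Xmax_tail_le_Ssum x).
lra.
Unshelve. all: by end_near. Qed.

End tail.
End max_sum.

(** * Conditional expectations *)

(* Since [inf set0 = 0], nonemptiness of the set defining [VaR P Y q] matters: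
   it holds because the tail of [Y] takes arbitrarily small values. *)
Lemma VaR_cvgy {R : realType} {d : measure_display} {T : measurableType d}
    (P : probability T R) (Y : T -> R) : measurable_fun setT Y ->
  let G x := prob P [set w | x < Y w] in
  (forall x, 0 < G x) -> (forall e, 0 < e -> exists x, G x <= e) ->
  VaR P Y q @[q --> 1^'-] --> +oo.
Proof.
move=> mY G G0 Gsmall; apply/cvgryPge => A.
near=> q.
have q1 : q < 1 by near: q; exact: nbhs_left_lt.
have qA : 1 - G A < q.
  by near: q; apply: nbhs_left_gt; have := G0 A; lra.
apply: lb_le_inf.
  have [|x Gx] := Gsmall (1 - q); first lra.
  by exists x => /=; rewrite prob_le_tail// -/(G x); lra.
move=> x /=; rewrite prob_le_tail// -/(G x) => qx.
rewrite leNgt; apply/negP => xA.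
have := tail_noninc P _ mY x A (ltW xA); rewrite -/(G x) -/(G A); lra.
Unshelve. all: by end_near. Qed.

(** [k / g] is at least [(k / s) / (1 + e)], and as [k / s <= 1] the division by [1 + e] costs at
    most [e]. *)
Lemma ratio_perturb_le {R : realFieldType} (k s g e : R) :
  0 <= k <= s -> 0 < s -> 0 < g -> 0 < e -> g <= (1 + e) * s ->
  k / s - e <= k / g.
Proof.
move=> /andP[k0 ks] s0 g0 e0 gs; rewrite ler_pdivlMr//.
have [se|es] := leP (k / s) e; first by apply: (le_trans _ k0); nra.
have kE : k = k / s * s by rewrite divfK// gt_eqF.
have r1 : k / s <= 1 by rewrite ler_pdivrMr// mul1r.
rewrite [leRHS]kE; move: (k / s) es r1 => r er r1.
have re : (r - e) * g <= (r - e) * ((1 + e) * s) by rewrite ler_wpM2l// subr_ge0 ltW.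
have : 0 <= e * (1 + e - r) * s by rewrite !mulr_ge0//; lra.
lra.
Qed.

Section conditional.
Context {R : realType} {d : measure_display} {T : measurableType d}.
Variables (P : probability T R) (n : nat) (X : 'I_n -> T -> R).
Hypothesis mX : forall i, measurable_fun setT (X i).
Hypothesis X0 : forall i w, 0 <= X i w.

Let G x := prob P [set w | x < Ssum X w].
Let tail_sum (J : {set 'I_n}) x := \sum_(i in J) prob P [set w | x < X i w].
Let I (J : {set 'I_n}) x :=
  (\int[P]_(w in [set w | (x < Ssum X w)%R]) (\sum_(i in J) X i w)%:E)%E.

Let mS x : measurable [set w | x < Ssum X w].
Proof. exact/measurable_tail/measurable_Ssum. Qed.

Let mXE (i : 'I_n) (D : set T) : measurable D -> measurable_fun D (EFin \o X i).
Proof. by move=> mD; apply/measurable_EFinP; exact: measurable_funTS. Qed.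

(** Markov's inequality on [X i > x], an event contained in [Ssum X > x] by nonnegativity. *)
Let integral_component_ge (i : 'I_n) (x : R) : 0 <= x ->
  ((x * prob P [set w | (x < X i w)%R])%:E <=
   \int[P]_(w in [set w | (x < Ssum X w)%R]) (X i w)%:E)%E.
Proof.
move=> x0; have mi := measurable_tail _ x (mX i).
apply: (@le_trans _ _ (\int[P]_(w in [set w | (x < X i w)%R]) (X i w)%:E)%E); last first.
  apply: ge0_subset_integral => //; [exact: mXE|by move=> w _; rewrite lee_fin|].
  move=> w /= /lt_le_trans; apply.
  by rewrite /Ssum (bigD1 i)//= lerDl sumr_ge0.
apply: (@le_trans _ _ (\int[P]_(w in [set w | (x < X i w)%R]) (cst x%:E w))%E).
  by rewrite integral_cst// EFinM [X in (_ <= _ * X)%E](probE P _ mi).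
apply: ge0_le_integral => //; first exact: mXE.
by move=> w /= /ltW; rewrite lee_fin.
Qed.

Let integral_sum_ge J (x : R) : 0 <= x -> ((x * tail_sum J x)%:E <= I J x)%E.
Proof.
move=> x0; rewrite /I /tail_sum mulr_sumr.
rewrite -big_enum -sumEFin /=.
under eq_integral do rewrite -big_enum -sumEFin /=.
rewrite ge0_integral_sum//; last 2 first.
- by move=> i; exact: mXE.
- by move=> i w _; rewrite lee_fin.
by apply: lee_sum => i _; exact: integral_component_ge.
Qed.

Let integral_split J x : (\int[P]_(w in [set w | (x < Ssum X w)%R]) (Ssum X w)%:E =
  I J x + I (~: J)%SET x)%E.
Proof.
have mI (K : {set 'I_n}) : measurable_fun [set w | x < Ssum X w]
    (EFin \o (fun w => \sum_(i in K) X i w)).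
  apply/measurable_EFinP.
  rewrite (_ : (fun w => _) = (fun w => \sum_(i <- enum K) X i w)); last first.
    by apply/funext => w; rewrite big_enum.
  by apply: measurable_sum => i; exact: measurable_funTS.
rewrite /I -ge0_integralD//; last 4 first.
- by move=> w _; rewrite lee_fin sumr_ge0.
- exact: mI.
- by move=> w _; rewrite lee_fin sumr_ge0.
- exact: mI.
apply: eq_integral => w _; rewrite -EFinD /Ssum (bigID (mem J))/=.
by congr (_ + _)%:E; apply: eq_bigl => i; rewrite inE.
Qed.

(** The lower bound is direct. For the upper one, the lower bound for the complement of [J] is
    subtracted from the total; one [e] comes from the tail integral, the other from replacing [G x]
    by [sum_tails]. *)
Lemma conditional_tail_ratio (J : {set 'I_n}) (x e : R) :
  let sum_tails := \sum_(i < n) prob P [set w | x < X i w] in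
  let ratio := tail_sum J x / sum_tails in
  let c := (I J x * ((G x * x)^-1)%:E)%E in
  0 < x -> 0 < e -> 0 < G x -> 0 < sum_tails -> G x <= (1 + e) * sum_tails ->
  (\int[P]_(w in [set w | (x < Ssum X w)%R]) (Ssum X w)%:E
     <= ((1 + e) * (x * G x))%:E)%E ->
  (ratio%:E <= c + e%:E)%E /\ (c <= ratio%:E + (e + e)%:E)%E.
Proof.
move=> s r c x0 e0 G0 s0 Gs; rewrite (integral_split J).
have x0' := ltW x0.
have HJ := integral_sum_ge J x x0'.
have HC := integral_sum_ge (~: J)%SET x x0'.
have sE : s = tail_sum J x + tail_sum (~: J)%SET x.
  rewrite /s /tail_sum (bigID (mem J))/=; congr (_ + _).
  by apply: eq_bigl => i; rewrite inE.
have t0 K : 0 <= tail_sum K x by apply: sumr_ge0 => i _; exact: prob_ge0.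
have tJ := t0 J; have tC := t0 (~: J)%SET.
move=> Hsum; have : (I J x + (x * tail_sum (~: J)%SET x)%:E
    <= ((1 + e) * (x * G x))%:E)%E by apply: le_trans Hsum; rewrite leeD2l.
(* The lower bound excludes [-oo], the upper one [+oo]. *)
rewrite /c; case: (I J x) HJ => [a| |] //=; rewrite lee_fin => xa.
rewrite -EFinD lee_fin => ax.
have rJ : tail_sum J x / s - e <= tail_sum J x / G x.
  by apply: ratio_perturb_le => //; rewrite tJ sE lerDl.
have rC : tail_sum (~: J)%SET x / s - e <= tail_sum (~: J)%SET x / G x.
  by apply: ratio_perturb_le => //; rewrite tC sE lerDr.
have aE : a * (G x * x)^-1 = (a / x) / G x.
  by rewrite invfM mulrA mulrAC.
have s1 : tail_sum J x / s + tail_sum (~: J)%SET x / s = 1.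
  by rewrite -mulrDl -sE mulfV// gt_eqF.
rewrite -!EFinM -!EFinD !lee_fin aE; split.
  have : tail_sum J x / G x <= a / x / G x; last by rewrite /r; lra.
  by rewrite ler_pM2r ?invr_gt0// ler_pdivlMr// mulrC.
have : a / x / G x <= (1 + e) - tail_sum (~: J)%SET x / G x; last by rewrite /r; lra.
rewrite ler_pdivrMr// mulrBl divfK ?gt_eqF// ler_pdivrMr//.
by lra.
Qed.

End conditional.

(** * Evaluation of the bounds at the value at risk *)

Theorem theorem4p1 (R : realType) (d : measure_display) (T : measurableType d)
  (P : probability T R) (n : nat) (X : 'I_n -> {RV P >-> R}) (h : R -> R)
  (Om : {set 'I_n}) :
  (2 <= n)%N ->
  (forall i w, 0 <= X i w) ->
  (forall i, prob P [set w | X i w = 0] < 1) ->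
  upper_endpoint (fun x => prob P [set w | Xmax X w <= x]) = +oo%E ->
  (forall x, 0 < h x) ->
  GMDA (fun x => prob P [set w | Xmax X w <= x]) h ->
  (forall (i j : 'I_n), i != j -> forall t : R, 0 < t ->
     (fun x => prob P [set w | t * h x < `|X i w| /\ x < X j w]
               / prob P [set w | x < Xmax X w]) @ +oo --> 0) ->
  (exists L : R, 0 < L /\ forall (i j : 'I_n), (i < j)%N ->
     (fun x => prob P [set w | L * h x < X i w /\ L * h x < X j w]
               / prob P [set w | x < Xmax X w]) @ +oo --> 0) ->
  Om != finset.set0 ->
  let ratio := fun x : R => ((\sum_(i in Om) prob P [set w | x < X i w])
                           / (\sum_(i < n) prob P [set w | x < X i w]))%:E in
  let u := limf_einf ratio (pinfty_nbhs R) in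
  let U := limf_esup ratio (pinfty_nbhs R) in
  let c := cte_ratio P X Om in
  [/\ (u <= limf_einf c (1^'-))%E,
      (limf_einf c (1^'-) <= limf_esup c (1^'-))%E
    & (limf_esup c (1^'-) <= U)%E].
Proof.
move=> n2 X0 _ endp h0 gmda asym [L [L0 pairL]] _ ratio u U c.
pose Y i : T -> R := X i.
have mY i : measurable_fun setT (Y i) by exact: measurable_funPT.
have n0 : (0 < n)%N by exact: ltnW.
have mM := measurable_Xmax _ _ mY.
have mS := measurable_Ssum _ _ mY.
have F0 := Xmax_tail_gt0 P _ _ mY endp.
have gumbel y : (fun x => prob P [set w | x + y * h x < Xmax Y w]
    / prob P [set w | x < Xmax Y w]) @ +oo --> expR (- y).
  have := gmda y; rewrite /to_endpoint endp; apply: cvg_trans.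
  apply: near_eq_cvg; apply: nearW => x.
  by rewrite !(prob_le_tail P (Xmax X))// !subKr.
have tail_le := Ssum_tail_le P _ _ mY X0 _ n0 F0 h0 gumbel asym _ L0 pairL.
have rapid := Ssum_rapid_variation P _ _ mY X0 _ n0 F0 h0 gumbel asym _ L0 pairL.
have FG := Xmax_tail_le_Ssum P _ _ mY X0.
have Fs := Xmax_tail_le_sum P _ _ mY.
have G0 x : 0 < prob P [set w | x < Ssum Y w] by exact: lt_le_trans (F0 x) (FG x).
have VaRy : VaR P (Ssum Y) q @[q --> 1^'-] --> +oo.
  (* Arbitrarily small tails: [G (2 x) <= e G x <= e]. *)
  have two : 1 < 2 :> R by rewrite ltr1n.
  apply: VaR_cvgy => // e e0.
  have [x Gx] := @filter_ex _ _ _ _ (rapid 2 e two e0).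
  exists (2 * x); apply: (le_trans Gx); rewrite ler_piMr//; first exact: ltW.
  by rewrite -lee_fin -probE ?probability_le1//; exact: measurable_tail.
have bounds e : 0 < e -> \forall q \near 1^'-,
    (ratio (VaR P (Ssum Y) q) <= c q + e%:E)%E /\
    (c q <= ratio (VaR P (Ssum Y) q) + e%:E)%E.
  move=> e0; have e2 : 0 < e / 2 by rewrite divr_gt0.
  pose C x := (\int[P]_(w in [set w | (x < Ssum Y w)%R]) (\sum_(i in Om) Y i w)%:E *
    ((prob P [set w | (x < Ssum Y w)%R] * x)^-1)%:E)%E.
  (* The two-sided estimate holds for all large [x] and is pulled back along [VaR]; [e / 2] absorbs
     the doubled error. *)
  apply: (VaRy [set x | (ratio x <= C x + e%:E)%E /\ (C x <= ratio x + e%:E)%E]).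
  near=> x.
  have x0 : 0 < x by near: x; exact: nbhs_pinfty_gt (num_real _).
  have s0 : 0 < \sum_i prob P [set w | x < Y i w].
    exact: lt_le_trans (F0 x) (Fs _ (ltW x0)).
  have Gs : prob P [set w | x < Ssum Y w] <=
      (1 + e / 2) * \sum_i prob P [set w | x < Y i w].
    apply: (@le_trans _ _ ((1 + e / 2) * prob P [set w | x < Xmax Y w])).
      by near: x; exact: tail_le.
    by rewrite ler_wpM2l ?Fs ?(ltW x0)//; lra.
  have [|H1 H2] := conditional_tail_ratio P _ _ mY X0 Om _ _ x0 e2 (G0 x) s0 Gs.
    by near: x; exact: rapid_variation_tail_integral.
  rewrite /=; split; last by move: H2; rewrite -splitr.
  apply: (le_trans H1); rewrite leeD2l// lee_fin; lra.
split.
- apply: (limf_einf_comp_ge _ _ _ VaRy) => e e0.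
  by apply: filterS (bounds e e0) => q [].
- exact: limf_einf_le_esup.
- apply: (limf_esup_comp_le _ _ _ VaRy) => e e0.
  by apply: filterS (bounds e e0) => q [].
Unshelve. all: by end_near. Qed.
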